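(* Let $m\ge 2$ and let $n,r$ be positive integers with $n\ge 2r$. Then the graph $K_n^m$ has the $r$-EKR property.
   Context: All graphs are finite and simple. For a graph $G$ and $r\in\mathbb{N}$, $\mathcal{I}^{(r)}(G)$ denotes the family of independent $r$-subsets of $V(G)$. A subfamily $\mathcal{A}\subseteq\mathcal{I}^{(r)}(G)$ is intersecting if every two members have nonempty intersection. For $v\in V(G)$, the $r$-star centered at $v$ is $\mathcal{I}^{(r)}_v(G)=\{A\in\mathcal{I}^{(r)}(G): v\in A\}$. A graph $G$ has the $r$-EKR property (is $r$-EKR) if every largest intersecting subfamily of $\mathcal{I}^{(r)}(G)$ is an $r$-star, i.e., all its members contain a common vertex. The graph $K_n^m$ is obtained from the complete graph $K_n$ with vertices $v_1,\dots,v_n$ by attaching, for each $i\in[n]$, a new clique on $m$ vertices $v^i_1,\dots,v^i_m$, each of which is adjacent to $v_i$ and to no other vertex of $K_n$ (distinct attached cliques have no edges between them). *)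

(* Defs.v *)
From mathcomp Require Import all_boot.

Set Implicit Arguments.
Unset Strict Implicit.
Unset Printing Implicit Defensive.

Record sgraph := SGraph {
  vertex :> finType;
  adj : rel vertex;
  adj_sym : symmetric adj;
  adj_irrefl : irreflexive adj
}.

Arguments adj {G} : rename.

Section EKR.
Variable G : sgraph.
Implicit Types (S : {set G}) (A B : {set {set G}}) (v : G) (r : nat).

Definition independent S : bool :=
  [forall x in S, forall y in S, ~~ adj x y].

Definition indep_family r : {set {set G}} :=
  [set S | independent S & #|S| == r].

(* The two members need not be distinct; for r-sets with r > 0 this makes no
   difference. *)
Definition intersecting A : Prop :=
  forall S T, S \in A -> T \in A -> S :&: T != set0.

Definition star r v : {set {set G}} := [set S in indep_family r | v \in S].

Definition intersecting_subfamily r A : Prop :=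
  A \subset indep_family r /\ intersecting A.

Definition largest_intersecting r A : Prop :=
  intersecting_subfamily r A /\
  (forall B, intersecting_subfamily r B -> #|B| <= #|A|).

Definition EKR r : Prop :=
  forall A, largest_intersecting r A -> exists v, A = star r v.

End EKR.

Section CliquesOnClique.
Variables n m : nat.

(* [inl i] is the vertex v_i of K_n, and [inr (i, j)] is the j-th vertex v^i_j
   of the clique attached at v_i. *)
Definition Knm_vertex : finType := ('I_n + 'I_n * 'I_m)%type.

Definition Knm_adj : rel Knm_vertex := fun x y =>
  match x, y with
  | inl i, inl k => i != k
  | inl i, inr (k, _) => i == k
  | inr (i, _), inl k => i == k
  | inr (i, j), inr (k, l) => (i == k) && (j != l)
  end.

Lemma Knm_adj_sym : symmetric Knm_adj.
Proof. by move=> [i|[i j]] [k|[k l]] /=; rewrite eq_sym // (eq_sym j). Qed.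

Lemma Knm_adj_irrefl : irreflexive Knm_adj.
Proof. by move=> [i|[i j]] /=; rewrite !eqxx. Qed.

Definition Knm : sgraph := SGraph Knm_adj_sym Knm_adj_irrefl.

End CliquesOnClique.

(* Main.v *)
(** Each independent set of K_n^m is a partial choice of labels on the n blocks
{v_i, v^i_1, ..., v^i_m}, using at most one vertex of the central clique.
Replacing v_i by v^i_1 (a shift) keeps a family intersecting, and a largest
family that is shifted into a star was already a star.  In a family stable under
all shifts any two members meet outside the central clique.  The members
avoiding that clique then form an intersecting family of labelled r-sets; the
others, after deletion of their central vertex, an intersecting family of
labelled (r-1)-sets, each arising from at most n-r+1 members.  The Erdős–Ko–Rado
bounds for labelled sets add up exactly to the size of the star at a pendant
vertex, so the labelled r-sets attain their bound, hence all share a point x;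
since there are two labels to choose from, every member contains x.

The labelled theorem is Katona's cycle argument: n cyclic windows on each of m
label levels, averaged over the permutations that respect blocks.  Windows on
different levels are disjoint, so an intersecting family contains at most r of
the nm. *)

Require Import Defs.
From mathcomp Require Import all_boot all_fingroup.
From mathcomp Require Import zify.

Set Implicit Arguments.
Unset Strict Implicit.
Unset Printing Implicit Defensive.

(** * Double counting and permutations of finite sets *)

(** For a fixed [k] the fibres over [O] are equally large, so [phi^~ k] lands in [F] for a
    proportion [#|F| / #|O|] of the [g]; then sum over [k]. *)
Lemma double_count (X K Y : finType) (G : {set X}) (phi : X -> K -> Y)
    (O F : {set Y}) :
  F \subset O ->
  (forall g k, g \in G -> phi g k \in O) ->
  (forall k, {in O &, forall A B,
     #|[set g in G | phi g k == A]| = #|[set g in G | phi g k == B]|}) ->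
  #|O| * (\sum_(g in G) #|[set k | phi g k \in F]|) = #|F| * #|G| * #|K|.
Proof.
move=> sFO phiO cst.
have fib k (E : {set Y}) :
    #|[set g in G | phi g k \in E]| =
    \sum_(A in E) #|[set g in G | phi g k == A]|.
  rewrite -sum1dep_card (partition_big (phi^~ k) (mem E)) /=; last first.
    by move=> g /andP[].
  apply: eq_bigr => A EA; rewrite -sum1dep_card; apply: eq_bigl => g.
  by case: eqP => [->|]; rewrite ?andbF ?andbT // [A \in E]EA andbT.
have swap : \sum_(g in G) #|[set k | phi g k \in F]| =
    \sum_(k : K) #|[set g in G | phi g k \in F]|.
  under eq_bigr => g _ do rewrite -sum1dep_card big_mkcond.
  rewrite exchange_big; apply: eq_bigr => k _.
  by rewrite -big_mkcondr sum1dep_card.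
rewrite swap big_distrr /= -[#|K|]sum1_card big_distrr /=.
apply: eq_bigr => k _; rewrite muln1 fib big_distrr /= -[#|F|]sum1_card big_distrl /=.
apply: eq_bigr => A FA; rewrite mul1n.
have -> : #|G| = #|[set g in G | phi g k \in O]|.
  by apply: eq_card => g; rewrite inE; case Gg: (g \in G); rewrite // phiO.
rewrite fib -sum1_card big_distrl /=; apply: eq_bigr => B OB.
by rewrite mul1n; apply: cst => //; apply: (subsetP sFO).
Qed.

(** List [A] and then its complement, do the same for [B], and match positions. *)
Lemma perm_imset_eq (T : finType) (A B : {set T}) :
  #|A| = #|B| -> exists p : {perm T}, p @: A = B.
Proof.
move=> eqAB.
pose l (A : {set T}) := enum A ++ enum (~: A).
have lU E : uniq (l E).
  rewrite cat_uniq !enum_uniq andbT /=; apply/hasPn => x.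
  by rewrite !mem_enum inE.
have lall E x : x \in l E by rewrite mem_cat !mem_enum inE orbN.
have sl E F : size (l E) = size (l F).
  by rewrite !size_cat -!cardE !cardsC.
pose f x := nth x (l B) (index x (l A)).
have f_inj : injective f.
  move=> x y; rewrite /f (set_nth_default x y) ?(sl B A) ?index_mem //.
  move/eqP; rewrite nth_uniq ?(sl B A) ?index_mem // => /eqP.
  by move/index_inj; apply.
exists (perm f_inj); apply/eqP.
rewrite eqEcard card_imset ?eqAB ?leqnn ?andbT; last exact: perm_inj.
apply/subsetP => _ /imsetP[x Ax ->]; rewrite permE /f /l index_cat mem_enum Ax.
have lt : index x (enum A) < size (enum B).
  by rewrite -cardE -eqAB cardE index_mem mem_enum.
by rewrite nth_cat lt -mem_enum mem_nth.
Qed.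

(** * Starts of pairwise meeting arcs on a cycle *)

Section Cycle.
Variable n : nat.

(** Forward steps from [t] to [b] on the cycle of length [n], written without [modn] so that [lia]
    applies. *)
Definition offset (t b : nat) : nat := if t <= b then b - t else n + b - t.

Lemma offsetP (t b : 'I_n) :
  exists d, [/\ offset t b = d, d < n & d + t = b \/ d + t = n + b].
Proof.
exists (offset t b); rewrite /offset; have := ltn_ord t; have := ltn_ord b.
by case: (leqP t b) => ? ? ?; split; lia.
Qed.

(** Walk forward from a point [v] outside [S]: [t] is the first point of [S] met, and [u] its
    predecessor. *)
Lemma cycle_boundary (S : {set 'I_n}) : S != set0 -> S != setT ->
  exists t u, [/\ t \in S, u \notin S & offset u t = 1].
Proof.
case/set0Pn=> s Ss; rewrite eqEsubset subsetT => /subsetPn[v _ Sv].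
case: (@arg_minnP _ s (mem S) (fun t : 'I_n => offset v t)) => //= t St t_min.
have n_gt0 : 0 < n by case: (t) => i; lia.
have ltu : (if val t == 0 then n.-1 else t.-1) < n.
  by have := ltn_ord t; case: ifP; lia.
pose u := Ordinal ltu.
have uE : t = u.+1 :> nat \/ t = 0 :> nat /\ n = u.+1 by rewrite /=; case: ifP; lia.
have nvt : v <> t :> nat by move/val_inj => vt; rewrite vt St in Sv.
move: (u) uE => {ltu}u uE.
exists t, u; split=> //; last first.
  have [a [-> an ?]] := offsetP u t.
  have := ltn_ord t; have := ltn_ord u; have := ltn_ord v; lia.
apply/negP => /t_min.
have [a [-> an ?]] := offsetP v t; have [b [-> bn ?]] := offsetP v u.
have := ltn_ord t; have := ltn_ord v; have := ltn_ord u; lia.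
Qed.

Variables (r : nat) (S : {set 'I_n}).
Hypotheses (r_le : 2 * r <= n)
  (S_close : {in S &, forall s t : 'I_n, (offset s t < r) || (offset t s < r)}).

(* Katona's pairing: the starts at distances d and n - r + d from t cannot
   both lie in S, since the windows there are disjoint. *)
Let fold (t s : 'I_n) :=
  let d := offset t s in if d < r then d else d - (n - r).

(** A start at least [r] steps after [t] reaches [t] again in fewer than [r] steps, so its distance
    from [t] exceeds [n - r]. *)
Let foldP t s : t \in S -> s \in S -> exists d,
  [/\ fold t s = d, d < r & (offset t s = d) \/ (0 < d /\ offset t s = d + (n - r))].
Proof.
move=> St Ss; exists (fold t s); have := S_close St Ss; rewrite /fold.
have [d [-> dn td]] := offsetP t s; have [e [-> en te]] := offsetP s t.
have := ltn_ord t; have := ltn_ord s; case: (ltnP d r) => *; split; lia.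
Qed.

Let fold_uniq t : t \in S -> uniq [seq fold t s | s <- enum S].
Proof.
move=> St; rewrite map_inj_in_uniq ?enum_uniq // => s s'.
rewrite !mem_enum => Ss Ss' ss'; apply: val_inj => /=.
have := S_close Ss Ss'.
have [d [-> dn ?]] := offsetP s s'; have [d' [-> dn' ?]] := offsetP s' s.
have [e [es er]] := foldP St Ss; have [e' [es' er']] := foldP St Ss'.
have ee : e = e' by rewrite -es -es'.
subst e'; have [c [-> cn ?]] := offsetP t s; have [c' [-> cn' ?]] := offsetP t s'.
have := ltn_ord t; have := ltn_ord s; have := ltn_ord s'; lia.
Qed.

Let fold_sub t :
  t \in S -> {subset [seq fold t s | s <- enum S] <= iota 0 r}.
Proof.
move=> St d /mapP[s]; rewrite mem_enum mem_iota => Ss ->.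
by have [e [-> ? _]] := foldP St Ss.
Qed.

Lemma card_cycle_le : #|S| <= r.
Proof.
have [->|[t St]] := set_0Vmem S; first by rewrite cards0.
have := uniq_leq_size (fold_uniq St) (fold_sub St).
by rewrite size_map -cardE size_iota.
Qed.

(** With [r] starts, every value of [fold] is attained. The value [r.-1] belongs to the distances
    [r.-1] and [n.-1] from [t]; the second is that of [u], which lies outside [S]. *)
Lemma cycle_eq_next (t u s : 'I_n) : #|S| = r -> t \in S -> u \notin S ->
  offset u t = 1 -> offset t s = r.-1 -> s \in S.
Proof.
move=> cS St Su ut ts.
have r_gt0 : 0 < r by rewrite -cS card_gt0; apply/set0Pn; exists t.
have [|_ /(_ r.-1)] := uniq_min_size (fold_uniq St) (fold_sub St).
  by rewrite size_map -cardE size_iota cS.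
rewrite mem_iota; have -> : 0 <= r.-1 < 0 + r by lia.
case/mapP=> v; rewrite mem_enum => Sv.
have [d [-> dr]] := foldP St Sv => dv ed.
move: ut ts dv; have [a [-> an ?]] := offsetP u t.
have [b [-> bn ?]] := offsetP t s; have [c [-> cn ?]] := offsetP t v.
move=> ? ? []?.
  suff -> : s = v by [].
  by apply: val_inj => /=; have := ltn_ord s; have := ltn_ord v; lia.
case/negP: Su; suff -> : u = v by [].
by apply: val_inj => /=; have := ltn_ord u; have := ltn_ord v; lia.
Qed.

End Cycle.

(** * Labelled sets *)

Section Labelled.
Variables n m : nat.
Local Notation T := ('I_n * 'I_m)%type.
Implicit Types (p q x : T) (A B C D : {set T}) (g h : {perm T}).

Definition labelled D := #|fst @: D| == #|D|.

Definition labelled_sets r := [set D | labelled D & #|D| == r].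

Definition labelled_star r x := [set D in labelled_sets r | x \in D].

(** The automorphisms of the partition into blocks, a wreath product of symmetric groups. *)
Definition block_perms :=
  [set g : {perm T} | [forall p, forall q, ((g p).1 == (g q).1) == (p.1 == q.1)]].

Lemma labelledP D :
  reflect {in D &, forall p q, p.1 = q.1 -> p = q} (labelled D).
Proof. exact: imset_injP. Qed.

Lemma block_permsP g :
  reflect (forall p q, ((g p).1 == (g q).1) = (p.1 == q.1)) (g \in block_perms).
Proof.
rewrite inE; apply: (iffP forallP) => [H p q|H p].
  by have /forallP/(_ q)/eqP := H p.
by apply/forallP => q; rewrite H.
Qed.

Lemma block_perms1 : 1%g \in block_perms.
Proof. by apply/block_permsP => p q; rewrite !perm1. Qed.

Lemma block_permsM g h :
  g \in block_perms -> h \in block_perms -> (g * h)%g \in block_perms.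
Proof.
move=> /block_permsP gB /block_permsP hB; apply/block_permsP => p q.
by rewrite !permM hB gB.
Qed.

Lemma imset_labelled r g D :
  g \in block_perms -> D \in labelled_sets r -> g @: D \in labelled_sets r.
Proof.
move=> /block_permsP gB; rewrite !inE card_imset; last exact: perm_inj.
case/andP=> /labelledP Dlab ->; rewrite andbT; apply/labelledP.
move=> _ _ /imsetP[p Dp ->] /imsetP[q Dq ->] /eqP.
by rewrite gB => /eqP /(Dlab _ _ Dp Dq) ->.
Qed.

Lemma imset_permM (g h : {perm T}) D : (g * h)%g @: D = h @: (g @: D).
Proof. by rewrite -imset_comp; apply: eq_imset => p; rewrite /= permM. Qed.

Lemma relabel_inj (rho : 'I_n -> 'I_m -> 'I_m) (pi : {perm 'I_n}) :
  (forall b, injective (rho b)) ->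
  injective (fun p : T => (pi p.1, rho p.1 p.2) : T).
Proof.
by move=> rI [b l] [b' l'] /= [/perm_inj <- /rI <-].
Qed.

Lemma relabel_block_perm (rho : 'I_n -> 'I_m -> 'I_m) (pi : {perm 'I_n})
    (rI : forall b, injective (rho b)) :
  perm (relabel_inj (pi := pi) rI) \in block_perms.
Proof. by apply/block_permsP => p q; rewrite !permE /= (inj_eq perm_inj). Qed.

(** Carry the blocks of [A] to those of [B] by [pi], and swap in each block [b] the label of [A]
    with the label of [B] in [pi b]. *)
Lemma block_perms_trans r : {in labelled_sets r &, forall A B,
  exists2 g, g \in block_perms & g @: A = B}.
Proof.
move=> A B; rewrite !inE => /andP[labA cA] /andP[labB cB].
have [|pi pi_img] := @perm_imset_eq _ (fst @: A) (fst @: B).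
  by rewrite (eqP labA) (eqP labB) (eqP cA) (eqP cB).
have [A0|[p0 _]] := set_0Vmem A.
  exists 1%g; first exact: block_perms1.
  have -> : B = set0 by apply/eqP; rewrite -cards_eq0 (eqP cB) -(eqP cA) A0 cards0.
  by rewrite A0 imset0.
(* The default serves the blocks that [D] misses; any label would do, but one must exist, so an
   empty [A] was treated apart. *)
pose lab D b := odflt p0.2 [pick l | (b, l) \in D].
have lab_in D p : labelled D -> p \in D -> lab D p.1 = p.2.
  move=> /labelledP labD; case: p => b l /= Dp; rewrite /lab.
  case: pickP => [l' Dl'|/(_ l)]; last by rewrite Dp.
  by have [] := labD _ _ Dl' Dp erefl.
pose rho b : 'I_m -> 'I_m := tperm (lab A b) (lab B (pi b)).
have rI b : injective (rho b) by apply: perm_inj.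
exists (perm (relabel_inj (pi := pi) rI)); first exact: relabel_block_perm.
apply/eqP; rewrite eqEcard card_imset; last exact: perm_inj.
rewrite (eqP cA) (eqP cB) leqnn andbT.
apply/subsetP => _ /imsetP[p Ap ->]; rewrite permE /rho (lab_in A) // tpermL.
have : pi p.1 \in fst @: B by rewrite -pi_img !imset_f.
by case/imsetP => q Bq ->; rewrite (lab_in B) // -surjective_pairing.
Qed.

(** Points are labelled 1-sets, so block permutations act transitively on them and all stars have
    equal size; then count incidences between points and labelled sets. *)
Lemma card_labelled_star r x : n * m * #|labelled_star r x| = r * #|labelled_sets r|.
Proof.
have star_le y z : #|labelled_star r y| <= #|labelled_star r z|.
  have [||g gB gyz] := @block_perms_trans 1 [set y] [set z].
  - by rewrite !inE /labelled imset_set1 !cards1.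
  - by rewrite !inE /labelled imset_set1 !cards1.
  rewrite -(card_imset _ (imset_inj (@perm_inj _ g))); apply: subset_leq_card.
  apply/subsetP => _ /imsetP[D Dst ->]; move: Dst; rewrite inE => /andP[Dr Dy].
  rewrite inE imset_labelled //=; suff -> : z = g y by apply: imset_f.
  by apply/esym/set1P; rewrite -gyz imset_f ?set11.
have -> : n * m = #|{: T}| by rewrite card_prod !card_ord.
have -> : #|{: T}| * #|labelled_star r x| = \sum_(y : T) #|labelled_star r y|.
  rewrite -sum_nat_const; apply: eq_bigr => y _.
  by apply/eqP; rewrite eqn_leq !star_le.
under eq_bigr => y _ do rewrite -sum1dep_card big_mkcondr.
rewrite exchange_big /= mulnC -sum_nat_const; apply: eq_bigr => D.
by rewrite inE => /andP[_ /eqP <-]; rewrite -big_mkcond sum1_card.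
Qed.

(** An arc of [r] consecutive blocks from [k.1], all with label [k.2]: each label carries its own
    copy of Katona's cycle. *)
Definition window r (k : T) : {set T} :=
  [set p : T | (p.2 == k.2) && (offset n k.1 p.1 < r)].

Lemma window_labelled r k : r <= n -> window r k \in labelled_sets r.
Proof.
move=> rn; rewrite inE; apply/andP; split.
  apply/labelledP => p q; rewrite !inE => /andP[/eqP p2 _] /andP[/eqP q2 _] pq.
  by rewrite [p]surjective_pairing [q]surjective_pairing pq p2 q2.
case: k => a l; have na := ltn_ord a.
have lt (i : 'I_r) : (if a + i < n then a + i else a + i - n) < n.
  by have := ltn_ord i; case: ifP; lia.
pose f i : T := (Ordinal (lt i), l).
have f_inj : injective f.
  move=> i j [] e; apply: val_inj; move: e => /=.
  by have := ltn_ord i; have := ltn_ord j; case: ifP; case: ifP; lia.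
suff -> : window r (a, l) = f @: setT by rewrite card_imset // cardsT card_ord.
apply/setP => -[b l']; rewrite inE /=.
apply/andP/imsetP => [[/eqP -> br]|[i _ [-> ->]]].
  exists (Ordinal br) => //; congr pair; apply: val_inj => /=.
  have := ltn_ord b; have [d [-> dn ?]] := offsetP a b.
  by case: ifP; lia.
split=> //=; rewrite /offset; have := ltn_ord i.
by case: (ltnP (a + i) n) => ? ?; case: ifP; lia.
Qed.

Lemma window_meet r (k k' : T) : window r k :&: window r k' != set0 ->
  k.2 = k'.2 /\ (offset n k.1 k'.1 < r) || (offset n k'.1 k.1 < r).
Proof.
case: k k' => [s l] [t l'] /set0Pn[[b e]]; rewrite !inE /=.
move=> /andP[/andP[/eqP <- h] /andP[/eqP <- h']]; split=> //; move: h h'.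
have [? [-> ? ?]] := offsetP s b; have [? [-> ? ?]] := offsetP t b.
have [? [-> ? ?]] := offsetP s t; have [? [-> ? ?]] := offsetP t s.
have := ltn_ord s; have := ltn_ord t; have := ltn_ord b; lia.
Qed.

(** * Pairwise meeting windows across all labels *)

Section Windows.
Variables (r : nat) (K : {set T}).
Hypotheses (r_le : 2 * r <= n)
  (K_meet : {in K &, forall k k', window r k :&: window r k' != set0}).

Let starts := fst @: K.

Let starts_close : {in starts &, forall s t : 'I_n,
  (offset n s t < r) || (offset n t s < r)}.
Proof.
move=> _ _ /imsetP[k Kk ->] /imsetP[k' Kk' ->].
by have [] := window_meet (K_meet Kk Kk').
Qed.

(** Meeting windows share their label, so a window of [K] is determined by its start. *)
Let card_starts : #|starts| = #|K|.
Proof.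
apply: card_in_imset => k k' Kk Kk' e1.
have [e2 _] := window_meet (K_meet Kk Kk').
by rewrite [k]surjective_pairing [k']surjective_pairing e1 e2.
Qed.

Let in_starts (k : T) b : k \in K -> ((b, k.2) \in K) = (b \in starts).
Proof.
move=> Kk; apply/idP/imsetP => [Kb|[k' Kk' ->]]; first by exists (b, k.2).
have [-> _] := window_meet (K_meet Kk Kk'); by rewrite -surjective_pairing.
Qed.

Lemma card_windows_le : #|K| <= r.
Proof. by rewrite -card_starts; apply: card_cycle_le r_le starts_close. Qed.

Lemma windows_next (t u s : 'I_n) (l : 'I_m) : #|K| = r ->
  (t, l) \in K -> (u, l) \notin K -> offset n u t = 1 -> offset n t s = r.-1 ->
  (s, l) \in K.
Proof.
rewrite -card_starts => cK Kt; rewrite !(in_starts _ Kt) => Ku.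
apply: (cycle_eq_next r_le starts_close) => //.
by apply/imsetP; exists (t, l).
Qed.

Lemma windows_boundary : 0 < r -> #|K| = r ->
  exists t u l, [/\ (t, l) \in K, (u, l) \notin K & offset n u t = 1].
Proof.
move=> r_gt0 cK; have /set0Pn[k Kk] : K != set0 by rewrite -card_gt0 cK.
have [||t [u [St Su ut]]] := @cycle_boundary n starts.
- by apply/set0Pn; exists k.1; apply: imset_f.
- apply/eqP => ST; have := card_starts; rewrite ST cardsT card_ord cK; lia.
by exists t, u, k.2; rewrite !in_starts.
Qed.

End Windows.

Hypothesis m_gt1 : 1 < m.

Lemma rot_label_inj (Z : {set 'I_n}) b :
  injective (fun l : 'I_m => if b \in Z then ordS l else l).
Proof. by move=> l l'; case: ifP => // _; apply: ordS_inj. Qed.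

(** This is how a second label is exploited: rotating the label in a block always gives a different
    vertex of that block. *)
Lemma ordS_neq (l : 'I_m) : ordS l != l.
Proof.
apply/eqP => /(congr1 val) /=; have := ltn_ord l; rewrite leq_eqVlt.
case/orP=> [/eqP e|lt]; last by rewrite modn_small //; lia.
by rewrite e modnn; lia.
Qed.

(** * Katona's averaging for labelled sets, with the case of equality *)

Section Intersecting.
Variables (r : nat) (F : {set {set T}}).
Hypotheses (r_le : 2 * r <= n) (FO : F \subset labelled_sets r)
  (F_meet : {in F &, forall A B, A :&: B != set0}).

Let hits g := [set k | g @: window r k \in F].

Let hits_meet g : {in hits g &, forall k k', window r k :&: window r k' != set0}.
Proof.
move=> k k'; rewrite !inE => Fk Fk'; have := F_meet Fk Fk'.
rewrite -imsetI; last by move=> ? ? _ _; apply: perm_inj.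
by apply: contraNneq => ->; rewrite imset0.
Qed.

Let hits_le g : #|hits g| <= r.
Proof. exact: card_windows_le r_le (@hits_meet g). Qed.

Let hits_sum : #|labelled_sets r| * (\sum_(g in block_perms) #|hits g|) =
  #|F| * #|block_perms| * (n * m).
Proof.
have -> : n * m = #|{: T}| by rewrite card_prod !card_ord.
(* Right multiplication by an [h] taking [A] to [B] injects the [g] sending a window to [A] into
   those sending it to [B]. *)
have c_le k A B : A \in labelled_sets r -> B \in labelled_sets r ->
    #|[set g in block_perms | g @: window r k == A]|
    <= #|[set g in block_perms | g @: window r k == B]|.
  move=> Ar Br; have [h hB hAB] := block_perms_trans Ar Br.
  rewrite -(card_imset _ (mulIg h)); apply: subset_leq_card.
  apply/subsetP => _ /imsetP[g /setIdP[gB /eqP gA] ->].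
  by apply/setIdP; rewrite block_permsM // imset_permM gA hAB.
apply: (double_count FO) => [g k gB|k A B Ar Br].
  by apply: imset_labelled gB _; apply: window_labelled; lia.
by apply/eqP; rewrite eqn_leq !c_le.
Qed.

Let block_perms_gt0 : 0 < #|block_perms|.
Proof. by rewrite card_gt0; apply/set0Pn; exists 1%g; apply: block_perms1. Qed.

(** Each block permutation sends at most [r] of the [n * m] windows into [F]; [hits_sum] averages
    this. *)
Lemma labelled_EKR_le : n * m * #|F| <= r * #|labelled_sets r|.
Proof.
rewrite -(leq_pmul2r block_perms_gt0) -(mulnA (n * m)) mulnC -hits_sum.
rewrite (mulnC r) -mulnA leq_mul2l; apply/orP; right.
by rewrite mulnC -sum_nat_const; apply: leq_sum => g _; apply: hits_le.
Qed.

(** The conclusion covers every labelled [C] meeting all of [F], because it will also be applied to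
    the pendant parts of independent sets that have a central vertex. *)
Lemma labelled_EKR_eq : 0 < r -> r * #|labelled_sets r| <= n * m * #|F| ->
  exists x, forall C, labelled C -> {in F, forall A, A :&: C != set0} -> x \in C.
Proof.
move=> r_gt0 F_ge; have n_gt0 : 0 < n by lia.
have O_gt0 : 0 < #|labelled_sets r|.
  rewrite card_gt0; apply/set0Pn; exists (window r (Ordinal n_gt0, Ordinal m_gt1)).
  by apply: window_labelled; lia.
(* The sum of the [#|hits g|] attains its maximum, so no term falls below [r]. *)
have hitsE g : g \in block_perms -> #|hits g| = r.
  move=> gB; apply/eqP; rewrite eqn_leq hits_le leqNgt; apply/negP => lt.
  have : \sum_(g in block_perms) #|hits g| < \sum_(g in block_perms) r.
    rewrite (bigD1 g) //= [X in _ < X](bigD1 g) //= -addSn leq_add //.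
    by apply: leq_sum => h _; apply: hits_le.
  rewrite -(ltn_pmul2l O_gt0) hits_sum sum_nat_const ltnNge => /negP[].
  rewrite mulnCA (mulnAC #|F|) (mulnC #|block_perms|) leq_mul2r.
  by rewrite mulnC (mulnC #|F|) F_ge orbT.
have [t [u [l [Kt Ku ut]]]] :=
  windows_boundary r_le (@hits_meet 1%g) r_gt0 (hitsE _ block_perms1).
(* [s] is the last block of the window at [t]. *)
have [s ts] : exists s : 'I_n, offset n t s = r.-1.
  have lt : (if t + r.-1 < n then t + r.-1 else t + r.-1 - n) < n.
    by have := ltn_ord t; case: ifP; lia.
  exists (Ordinal lt); rewrite /offset /=; have := ltn_ord t.
  by case: (ltnP (t + r.-1) n) => ? ?; case: ifP; lia.
exists (s, l) => C /labelledP Clab C_meet; apply/negPn/negP => Cx.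
pose B := window r (s, l); pose Z := fst @: (B :&: C).
(* Rotating the labels on the blocks Z where B meets C keeps the windows at t
   and u, hence forces the window at s to move to a member of F missing C. *)
pose h := perm (relabel_inj (pi := 1%g) (@rot_label_inj Z)).
have hB : h \in block_perms by apply: relabel_block_perm.
have hE p : h p = (p.1, if p.1 \in Z then ordS p.2 else p.2).
  by rewrite permE /= perm1.
(* The windows at [t] and [u] share no block with the window at [s], except possibly [s] itself, and
   [s] is not in [Z] because [(s, l)] is not in [C]. *)
have fixw v : v = t \/ v = u -> h @: window r (v, l) = window r (v, l).
  move=> tu; rewrite -[RHS]imset_id; apply: eq_in_imset => -[b e].
  rewrite inE /= => /andP[/eqP -> bv]; rewrite hE /=; case: ifP => //.
  case/imsetP=> -[b' e'] /setIP[+ Cb] /= eb; subst b'.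
  rewrite inE /= => /andP[/eqP ee sb]; subst e'; case/negP: Cx.
  suff -> : s = b by [].
  apply: val_inj => /=; move: bv sb ut ts.
  have := ltn_ord s; have := ltn_ord b; have := ltn_ord t; have := ltn_ord u.
  have [? [-> ? ?]] := offsetP s b; have [? [-> ? ?]] := offsetP u t.
  have [? [-> ? ?]] := offsetP t s; have [? [-> ? ?]] := offsetP v b.
  have : v = t :> nat \/ v = u :> nat by case: tu => ->; [left|right].
  lia.
have id_hits v : v = t \/ v = u -> ((v, l) \in hits h) = ((v, l) \in hits 1%g).
  move=> tu; rewrite !inE fixw //; congr (_ \in F).
  by rewrite -[LHS]imset_id; apply: eq_imset => p; rewrite perm1.
have : (s, l) \in hits h.
  apply: (windows_next r_le (@hits_meet h) (hitsE _ hB) _ _ ut ts).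
    by rewrite id_hits //; left.
  by rewrite id_hits //; right.
rewrite inE => /C_meet /set0Pn[p /setIP[/imsetP[q Bq ->]]].
have qlab : labelled B.
  by have /setIdP[] := window_labelled (s, l) (leq_trans (leq_addr _ _) r_le : r <= n).
rewrite hE; case: ifP => [/imsetP[q' /setIP[Bq' Cq'] eqq]|nZ].
  have e : q = q' by move/labelledP: qlab; apply.
  subst q' => /(Clab _ _ Cq') /(_ erefl) e.
  by have := ordS_neq q.2; rewrite {2}e /= eqxx.
rewrite -surjective_pairing => Cq; case/negP: nZ.
by apply: imset_f; apply/setIP.
Qed.

End Intersecting.
End Labelled.

(** * Shifting along a dominating edge *)

Section Shift.
Variables (G : sgraph) (r : nat).
Implicit Types (S A B : {set G}) (F : {set {set G}}) (a b x y z : G).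

Lemma independentP S : reflect {in S &, forall a b, ~~ adj a b} (independent S).
Proof.
apply: (iffP forall_inP) => [H a b Sa Sb|H a Sa].
  by have /forall_inP := H a Sa; apply.
by apply/forall_inP => b; apply: H.
Qed.

(** A star is itself intersecting, so a largest family inside it fills it. *)
Lemma largest_sub_star F z :
  largest_intersecting r F -> F \subset star r z -> F = star r z.
Proof.
move=> [_ F_max] Fz; apply/eqP; rewrite eqEcard Fz; apply: F_max; split.
  by apply/subsetP => S /setIdP[].
move=> A B /setIdP[_ Az] /setIdP[_ Bz]; apply/set0Pn; exists z.
by rewrite inE Az.
Qed.

Definition exchange x y S := y |: S :\ x.

(** A set whose exchanged form is already in [F] stays put, which keeps the shift injective on
    [F]. *)
Definition shift x y F S :=
  if (x \in S) && (exchange x y S \notin F) then exchange x y S else S.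

Variables (x y : G).
Hypotheses (xy : adj x y) (y_dom : forall z, adj y z -> z = x \/ adj x z).

Let notin_y S : S \in indep_family G r -> x \in S -> y \notin S.
Proof.
move=> /setIdP[/independentP indS _] Sx; apply/negP => Sy.
by have := indS x y Sx Sy; rewrite xy.
Qed.

(** By [y_dom], a neighbour of [y] in [S] other than [x] would be adjacent to [x]. *)
Lemma exchange_indep S : S \in indep_family G r -> x \in S ->
  exchange x y S \in indep_family G r.
Proof.
move=> Sr Sx; have Sy := notin_y Sr Sx; case/setIdP: Sr => /independentP indS /eqP cS.
apply/setIdP; split; last first.
  rewrite /exchange cardsU1 !inE negb_and Sy orbT /= -cS.
  by rewrite (cardsD1 x S) Sx.
have yS b : b \in S -> b != x -> ~~ adj y b.
  move=> Sb bx; apply/negP => /y_dom[/eqP|xb]; first by rewrite (negPf bx).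
  by have := indS x b Sx Sb; rewrite xb.
apply/independentP => a b; rewrite !inE.
case/predU1P=> [->|/andP[ax Sa]] /predU1P[->|/andP[bx Sb]].
- by rewrite adj_irrefl.
- exact: yS.
- by rewrite adj_sym; apply: yS.
- exact: indS.
Qed.

Variable F : {set {set G}}.
Hypothesis F_largest : largest_intersecting r F.

Let FI : {in F, forall S, S \in indep_family G r}.
Proof. by case: F_largest => -[/subsetP]. Qed.

Let exchangeK S : S \in F -> x \in S -> exchange y x (exchange x y S) = S.
Proof.
move=> FS Sx; rewrite /exchange setU1K ?setD1K //.
by rewrite !inE negb_and (notin_y (FI FS) Sx) orbT.
Qed.

Let shift_injF : {in F &, injective (shift x y F)}.
Proof.
move=> A B FA FB; rewrite /shift.
case: ifP => [/andP[Ax nA]|_]; case: ifP => [/andP[Bx nB]|_] //.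
- by move=> e; rewrite -(exchangeK FA Ax) e exchangeK.
- by move=> e; rewrite e FB in nA.
- by move=> e; rewrite -e FA in nB.
Qed.

(** The critical case has [x] but not [y] in [B]: then [B] is fixed only because [exchange x y B] is
    in [F], and [A] meets that set in a point other than [x] and [y]. *)
Let exchange_meet A B : A \in F -> B \in F -> x \in A -> shift x y F B = B ->
  exchange x y A :&: B != set0.
Proof.
move=> FA FB Ax; have [_ F_meet] := F_largest.1.
have [By _|nBy] := boolP (y \in B).
  by apply/set0Pn; exists y; rewrite !inE By eqxx.
have [Bx|nBx _] := boolP (x \in B); last first.
  have /set0Pn[a /setIP[Aa Ba]] := F_meet _ _ FA FB.
  apply/set0Pn; exists a; rewrite !inE Aa Ba andbT.
  by rewrite orbC; case: eqP Ba nBx => // -> ->.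
rewrite /shift Bx; case: ifP => [_ e|/negbFE FeB _].
  by case/negP: nBy; rewrite -e !inE eqxx.
have /set0Pn[a] := F_meet _ _ FA FeB; rewrite !inE.
case/andP=> Aa /predU1P[ay|/andP[ax Ba]].
  by have := notin_y (FI FA) Ax; rewrite -ay Aa.
by apply/set0Pn; exists a; rewrite !inE ax Aa Ba orbT.
Qed.

Lemma shift_largest : largest_intersecting r (shift x y F @: F).
Proof.
have [[_ F_meet] F_max] := F_largest.
split; last by move=> B /F_max; rewrite (card_in_imset shift_injF).
split.
  apply/subsetP => _ /imsetP[A FA ->]; rewrite /shift.
  by case: ifP => [/andP[Ax _]|_]; [apply: exchange_indep (FI FA) Ax | apply: FI].
have mv A : A \in F -> shift x y F A = A \/ x \in A /\ shift x y F A = exchange x y A.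
  by move=> FA; rewrite /shift; case: ifP => [/andP[Ax _]|_]; [right|left].
move=> _ _ /imsetP[A FA ->] /imsetP[B FB ->].
have [[eA|[Ax eA]] [eB|[Bx eB]]] := (mv A FA, mv B FB); rewrite eA eB.
- exact: F_meet.
- by rewrite setIC; apply: exchange_meet.
- exact: exchange_meet.
- by apply/set0Pn; exists y; rewrite !inE eqxx.
Qed.

(** The shift adds no vertex except [y], so [z] was in every member beforehand. *)
Lemma shift_star_other z : z != y -> shift x y F @: F = star r z -> F = star r z.
Proof.
move=> zy Fz; apply: (largest_sub_star F_largest); apply/subsetP => A FA.
apply/setIdP; split; first exact: FI.
have : shift x y F A \in star r z by rewrite -Fz imset_f.
case/setIdP=> _; rewrite /shift; case: ifP => // _.
by rewrite !inE (negPf zy) => /andP[].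
Qed.

End Shift.

(** * The graph K_n^m *)

Section Knm.
Variables n m : nat.
Local Notation T := ('I_n * 'I_m)%type.
Local Notation G := (Knm n m).
Implicit Types (S : {set G}) (D : {set T}) (E : {set {set T}}).

Definition block (a : G) : 'I_n := match a with inl k => k | inr p => p.1 end.

Definition central (a : G) : bool := if a is inl _ then true else false.

Definition base S : {set T} := [set p | inr p \in S].

Definition embed D : {set G} := inr @: D.

Definition extend (q : {set T} * 'I_n) : {set G} := inl q.2 |: embed q.1.

Lemma KnmE (a b : G) :
  adj a b = (a != b) && ((block a == block b) || (central a && central b)).
Proof.
case: a b => [i|[i j]] [k|[k l]] //=; rewrite ?andbF ?orbF ?orbT ?andbT //.
rewrite -[inr _ == inr _]/((i, j) == (k, l)) xpair_eqE negb_and.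
by case: (i == k); rewrite ?andbF ?andbT.
Qed.

Lemma Knm_independentP S :
  reflect {in S &, forall a b, a != b -> block a != block b /\ ~~ (central a && central b)}
    (independent S).
Proof.
apply: (iffP (independentP S)) => H a b Sa Sb; last first.
  rewrite KnmE; case: eqP => //= /eqP /(H a b Sa Sb)[].
  by move=> /negPf -> /negPf ->.
by move=> ab; have := H a b Sa Sb; rewrite KnmE ab negb_or => /andP.
Qed.

Lemma in_embed D p : (inr p \in embed D) = (p \in D).
Proof. by rewrite mem_imset // => ? ? []. Qed.

Lemma inl_embed D k : (inl k \in embed D) = false.
Proof. by apply/negP => /imsetP[]. Qed.

Lemma embedK D : base (embed D) = D.
Proof. by apply/setP => p; rewrite inE in_embed. Qed.

Lemma extendK D k : base (extend (D, k)) = D.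
Proof. by apply/setP => p; rewrite !inE in_embed. Qed.

Lemma card_embed D : #|embed D| = #|D|.
Proof. by apply: card_imset => ? ? []. Qed.

Lemma card_extend q : #|extend q| = #|q.1|.+1.
Proof. by rewrite cardsU1 inl_embed card_embed. Qed.

Lemma extend_inj : injective extend.
Proof.
move=> [D k] [D' k'] e; have := congr1 base e; rewrite !extendK => ->.
have : inl k \in extend (D', k') by rewrite -e !inE eqxx.
by rewrite !inE inl_embed orbF => /eqP[->].
Qed.

Lemma embed_independent D : independent (embed D) = labelled D.
Proof.
apply/Knm_independentP/labelledP => [H p q Dp Dq|H].
  have := H (inr p) (inr q); rewrite !in_embed => /(_ Dp Dq) /=.
  by case: (eqVneq p q) => // pq [] // /eqP.
move=> _ _ /imsetP[p Dp ->] /imsetP[q Dq ->] pq; split=> //=.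
by apply: contra pq => /eqP /(H p q Dp Dq) ->.
Qed.

Lemma extend_independent q :
  independent (extend q) = labelled q.1 && (q.2 \notin fst @: q.1).
Proof.
case: q => D k /=; apply/Knm_independentP/andP => [H|[/labelledP Dlab Dk]].
  split.
    rewrite -embed_independent; apply/Knm_independentP => a b Da Db.
    by apply: H; rewrite inE ?Da ?Db orbT.
  apply/negP => /imsetP[p Dp kp].
  have kE : inl k \in extend (D, k) by rewrite !inE eqxx.
  have pE : inr p \in extend (D, k) by rewrite !inE in_embed.
  by have [] := H _ _ kE pE isT; rewrite /= kp eqxx.
have Dlab' : independent (embed D) by rewrite embed_independent; apply/labelledP.
move=> a b; rewrite !inE.
have kD c : c \in embed D -> k != block c /\ ~~ central c.
  by case/imsetP=> p Dp ->; split=> //; apply: contraNneq Dk => /= ->; apply: imset_f.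
case/predU1P=> [->|Da] /predU1P[->|Db] ab.
- by rewrite eqxx in ab.
- by have [] := kD b Db.
- by have [kA cA] := kD a Da; rewrite eq_sym (negPf cA).
- exact: (Knm_independentP _ Dlab').
Qed.

Lemma independent_cases S : independent S ->
  S = embed (base S) \/ exists k, inl k \in S /\ S = extend (base S, k).
Proof.
move=> /Knm_independentP indS.
have [/existsP[k Sk]|no] := boolP [exists k, inl k \in S].
  right; exists k; split=> //; apply/setP => -[j|p]; rewrite !inE ?in_embed ?inE //.
  rewrite inl_embed orbF; apply/idP/eqP => [Sj|[->] //].
  by apply/eqP/negPn/negP => /(indS _ _ Sj Sk)[].
left; apply/setP => -[j|p]; rewrite ?in_embed ?inE //.
by rewrite inl_embed; apply: contraNF no => Sj; apply/existsP; exists j.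
Qed.

Lemma base_labelled S : independent S -> labelled (base S).
Proof.
move=> indS; have := independent_cases indS.
case=> [e|[k [_ e]]]; move: indS; rewrite {1}e ?embed_independent //.
by rewrite extend_independent => /andP[].
Qed.

Definition extensions E : {set {set T} * 'I_n} :=
  [set q | (q.1 \in E) && (q.2 \notin fst @: q.1)].

(** A labelled [r]-set leaves [n - r] blocks free for a central vertex. *)
Lemma card_extensions r E : E \subset labelled_sets n m r ->
  #|extensions E| = #|E| * (n - r).
Proof.
move=> Er; rewrite -sum1dep_card.
rewrite -(pair_big_dep (mem E) (fun D k => k \notin fst @: D) (fun _ _ => 1)) /=.
rewrite -sum_nat_const; apply: eq_bigr => D ED.
have /setIdP[/eqP Dlab /eqP cD] := subsetP Er _ ED.
rewrite sum1dep_card cardsCs card_ord -cD -Dlab; congr (n - _).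
by apply: eq_card => k; rewrite !inE negbK.
Qed.

(** The size is [r.+1] so that deleting a central vertex leaves a labelled [r]-set. *)
Lemma card_family r (F : {set {set G}}) : F \subset indep_family G r.+1 ->
  #|F| = #|[set D | embed D \in F]| + #|[set q | extend q \in F]|.
Proof.
move=> /subsetP Fr.
rewrite -(card_imset _ (can_inj embedK)) -(card_imset _ extend_inj).
rewrite -cardsUI [X in _ + X]eq_card0 ?addn0; last first.
  move=> S; rewrite !inE; apply/negP => /andP[/imsetP[D _ ->] /imsetP[q _ e]].
  have : inl q.2 \in extend q by rewrite !inE eqxx.
  by rewrite -e inl_embed.
apply: eq_card => S; rewrite inE; apply/idP/orP => [FS|].
  have /setIdP[indS _] := Fr _ FS.
  have [e|[k [_ e]]] := independent_cases indS; [left|right]; rewrite e.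
    by apply: imset_f; rewrite inE -e.
  by apply: imset_f; rewrite inE -e.
by case=> /imsetP[? + ->]; rewrite inE.
Qed.

Lemma card_star_inr r (x : T) : #|star r.+1 (inr x : G)| =
  #|labelled_star r.+1 x| + #|labelled_star r x| * (n - r).
Proof.
rewrite (@card_family r); last by apply/subsetP => S /setIdP[].
congr (_ + _).
  apply: eq_card => D; rewrite !inE in_embed -/(labelled D) -embed_independent.
  by rewrite card_embed.
rewrite -(@card_extensions r); last by apply/subsetP => D /setIdP[].
apply: eq_card => -[D k]; rewrite !inE extend_independent card_extend eqSS.
by rewrite in_embed /=; case: (labelled D) => //=; rewrite -andbA andbC.
Qed.

(** * Largest intersecting families of K_n^m *)

Hypothesis m_gt1 : 1 < m.

Lemma base_meet_star r (F : {set {set G}}) : 2 * r.+1 <= n ->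
  largest_intersecting r.+1 F ->
  {in F &, forall A B, base A :&: base B != set0} ->
  exists x : T, F = star r.+1 (inr x : G).
Proof.
move=> r_le F_largest F_base; have [[Fr _] F_max] := F_largest.
have n_gt0 : 0 < n by lia.
have nm_gt0 : 0 < n * m by rewrite muln_gt0 n_gt0 ltnW.
pose x0 : T := (Ordinal n_gt0, Ordinal m_gt1).
pose F0 := [set D | embed D \in F].
pose F1 := [set q | extend q \in F].
pose F' := fst @: F1.
have FI S : S \in F -> independent S by move/(subsetP Fr)/setIdP => [].
have F0r : F0 \subset labelled_sets n m r.+1.
  apply/subsetP => D; rewrite inE => /(subsetP Fr)/setIdP[].
  by rewrite embed_independent card_embed inE => -> ->.
have F'r : F' \subset labelled_sets n m r.
  apply/subsetP => _ /imsetP[q + ->]; rewrite inE => /(subsetP Fr)/setIdP[].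
  by rewrite extend_independent card_extend eqSS inE => /andP[-> _] ->.
have F0_meet : {in F0 &, forall A B, A :&: B != set0}.
  by move=> A B; rewrite !inE => FA FB; have := F_base _ _ FA FB; rewrite !embedK.
have F'_meet : {in F' &, forall A B, A :&: B != set0}.
  move=> _ _ /imsetP[[A k] + ->] /imsetP[[B j] + ->]; rewrite !inE => FA FB.
  by have := F_base _ _ FA FB; rewrite !extendK.
have F'_le : #|F'| <= #|labelled_star r x0|.
  have r_le' : 2 * r <= n by lia.
  rewrite -(leq_pmul2l nm_gt0) card_labelled_star.
  exact: labelled_EKR_le r_le' F'r F'_meet.
have F1_le : #|F1| <= #|labelled_star r x0| * (n - r).
  apply: leq_trans (leq_mul F'_le (leqnn _)); rewrite -(card_extensions F'r).
  apply/subset_leq_card/subsetP => -[D k] F1q; rewrite inE imset_f //=.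
  move: F1q; rewrite inE => /FI; rewrite extend_independent.
  by case/andP.
(* [F] is at least as large as the star at [inr x0], whose two summands in [card_star_inr] are the
   bounds for [F0] and [F1]; as [F1] stays within its own, [F0] must reach its bound. *)
have F0_ge : #|labelled_star r.+1 x0| <= #|F0|.
  rewrite -(leq_add2r (#|labelled_star r x0| * (n - r))) -card_star_inr.
  apply: leq_trans (leq_add (leqnn _) F1_le); rewrite -(card_family Fr).
  apply: F_max; split; first by apply/subsetP => S /setIdP[].
  move=> A B /setIdP[_ Ax] /setIdP[_ Bx]; apply/set0Pn; exists (inr x0).
  by rewrite inE Ax.
have [|x xP] := labelled_EKR_eq m_gt1 r_le F0r F0_meet (ltn0Sn r).
  by rewrite -(card_labelled_star r.+1 x0) leq_mul2l F0_ge orbT.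
exists x; apply: (largest_sub_star F_largest); apply/subsetP => S FS.
apply/setIdP; split; first exact: (subsetP Fr).
(* The base of any member is labelled and meets every set of [F0], a set of [F0] being the base of
   its embedding. *)
have : x \in base S.
  apply: xP => [|D]; first exact/base_labelled/FI.
  by rewrite inE => FD; have := F_base _ _ FD FS; rewrite embedK.
by rewrite inE.
Qed.

Lemma central_uniq S i j : independent S -> inl i \in S -> inl j \in S -> i = j.
Proof.
move=> /Knm_independentP indS Si Sj; apply/eqP/negPn/negP => ij.
by have [] := indS _ _ Si Sj ij.
Qed.

Lemma pendant_adj (k : 'I_n) (l : 'I_m) : adj (inl k : G) (inr (k, l)).
Proof. exact: eqxx. Qed.

Lemma pendant_dom (k : 'I_n) (l : 'I_m) (z : G) :
  adj (inr (k, l) : G) z -> z = inl k \/ adj (inl k : G) z.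
Proof. by case: z => [j|[j l']] /= => [/eqP ->|/andP[]]; [left|right]. Qed.

(** A member [A] without [y] was moved, so it contains [x]. Either [A] is just [{x}], which puts [F]
    inside the star at [x], or some set of the star at [y] is a member of [F] disjoint from [A]. *)
Lemma shift_star_same r (F : {set {set G}}) (i : 'I_n) (l : 'I_m) :
  largest_intersecting r.+1 F ->
  shift (inl i : G) (inr (i, l) : G) F @: F = star r.+1 (inr (i, l) : G) ->
  exists z, F = star r.+1 z.
Proof.
set x := (inl i : G); set y := (inr (i, l) : G) => F_largest Fy.
have [[Fr F_meet] _] := F_largest.
have [/forall_inP allF|] := boolP [forall A in F, y \in A].
  exists y; apply: (largest_sub_star F_largest); apply/subsetP => A FA.
  by apply/setIdP; split; [apply: (subsetP Fr)|apply: allF].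
case/forall_inPn=> A FA nAy.
have /setIdP[indA /eqP cA] := subsetP Fr _ FA.
have Ax : x \in A.
  have : shift x y F A \in star r.+1 y by rewrite -Fy imset_f.
  rewrite /shift; case: (x \in A) => //= /setIdP[_].
  by rewrite (negPf nAy).
have [eA|[k [Ak eA]]] := independent_cases indA.
  by move: Ax; rewrite eA inl_embed.
have ik := central_uniq indA Ax Ak; subst k.
set D := base A in eA; have cD : #|D| = r by move: cA; rewrite eA card_extend => -[].
have := indA; rewrite eA extend_independent /= => /andP[/labelledP Dlab Di].
have [D0|[d Dd]] := set_0Vmem D.
  exists x; apply: (largest_sub_star F_largest); apply/subsetP => B FB.
  apply/setIdP; split; first exact: (subsetP Fr).
  have /set0Pn[a /setIP[]] := F_meet _ _ FA FB.
  by rewrite eA D0 /extend /embed imset0 setU0 => /set1P ->.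
(* A member of the star at y that uses a vertex of the central clique cannot
   have been moved by the shift; this one is disjoint from A. *)
pose rot (p : T) : T := (p.1, ordS p.2).
have rot_inj : injective rot 
  by move=> [a b] [a' b'] /eqP; rewrite xpair_eqE => /andP[/eqP/= -> /eqP/ordS_inj ->].
(* [E] takes [y] in block [i], the central vertex in the block of [d], and a rotated label in each
   other block of [D]. *)
pose D' := (i, l) |: rot @: (D :\ d); pose E := extend (D', d.1).
have D'1 p : p \in D -> p.1 != i by move=> Dp; apply: contraNneq Di => <-; apply: imset_f.
have rotP p : p \in rot @: (D :\ d) -> exists q, [/\ q \in D, q != d & p = rot q].
  by case/imsetP=> q /setD1P[? ?] ->; exists q.
have Er : E \in indep_family G r.+1.
  rewrite inE extend_independent card_extend eqSS /=; apply/andP; split.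
    apply/andP; split.
      apply/labelledP => p q.
      case/setU1P=> [->|/rotP[p' [Dp _ ->]]] /setU1P[->|/rotP[q' [Dq _ ->]]] //=.
      - by move=> e; have := D'1 _ Dq; rewrite -e eqxx.
      - by move=> e; have := D'1 _ Dp; rewrite e eqxx.
      - by move=> /(Dlab _ _ Dp Dq) ->.
    apply/imsetP => -[p /setU1P[->|/rotP[p' [Dp pd ->]]]] /= e.
      by have := D'1 _ Dd; rewrite e eqxx.
    by move: pd; rewrite (Dlab _ _ Dp Dd) ?eqxx.
  rewrite cardsU1 card_imset // -cD (cardsD1 d D) Dd eqn_add2r.
  suff -> : (i, l) \notin rot @: (D :\ d) by [].
  by apply/negP => /rotP[q [Dq _ [e _]]]; have := D'1 _ Dq; rewrite -e eqxx.
have Ey : y \in E by rewrite !inE in_embed !inE eqxx.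
have : E \in shift x y F @: F by rewrite Fy; apply/setIdP.
case/imsetP=> B FB; rewrite /shift; case: ifP => [/andP[Bx _] eE|_ eE].
  have /setIdP[indB _] := subsetP Fr _ FB.
  have : inl d.1 \in E by rewrite !inE eqxx.
  rewrite eE !inE => /andP[di Bd]; case/negP: di.
  by rewrite (central_uniq indB Bd Bx).
have /set0Pn[a /setIP[]] : A :&: E != set0 by apply: F_meet; rewrite ?eE.
rewrite {1}eA /E /extend /=; case: a => [j|p].
  rewrite !in_setU1 !inl_embed !orbF => /eqP[->] /eqP[e].
  by have := D'1 _ Dd; rewrite e eqxx.
rewrite !in_setU1 !in_embed /= => Dp /setU1P[e|/rotP[q [Dq _ e]]].
  by have := D'1 _ Dp; rewrite e eqxx.
have pq : p = q by apply: Dlab; rewrite // e.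
by have := ordS_neq m_gt1 p.2; rewrite {2}e pq /= eqxx.
Qed.

(** Induction on the number of members with a central vertex, which drops under any shift that moves
    a member. *)
Lemma Knm_EKR r : 2 * r.+1 <= n -> EKR G r.+1.
Proof.
move=> r_le F; pose l : 'I_m := Ordinal m_gt1.
pose has_central S := [exists k, inl k \in S].
have [c] := ubnP #|[set S in F | has_central S]|.
elim: c F => // c IH F /ltnSE F_lt F_largest; have [[Fr F_meet] _] := F_largest.
have FI S : S \in F -> independent S by move/(subsetP Fr)/setIdP => [].
have [/existsP[i /exists_inP[A FA /andP[Ai nA]]]|stable] :=
  boolP [exists i, exists A in F,
    (inl i \in A) && (exchange (inl i : G) (inr (i, l) : G) A \notin F)].
  set x := (inl i : G) in Ai nA; set y := (inr (i, l) : G) in nA.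
  have shF : largest_intersecting r.+1 (shift x y F @: F).
    by apply: shift_largest F_largest; [apply: pendant_adj|apply: pendant_dom].
  have [||z zP] := IH (shift x y F @: F) => //.
    apply: leq_trans F_lt; apply: proper_card.
    have mv B : B \in F -> x \in B -> ~~ has_central (exchange x y B).
      move=> FB Bx; apply/existsPn => k; rewrite !inE; apply/negP => /andP[ki Bk].
      by case/negP: ki; rewrite (central_uniq (FI _ FB) Bk Bx).
    apply/properP; split.
      apply/subsetP => _ /setIdP[/imsetP[B FB ->] cB]; apply/setIdP.
      move: cB; rewrite /shift; case: ifP => // /andP[Bx _] cB.
      by have := mv _ FB Bx; rewrite cB.
    have Ac : has_central A by apply/existsP; exists i.
    (* [A] leaves the family: a moved member has no central vertex, and an unmoved one equal to [A]
       contradicts the choice of [A]. *)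
    exists A; first by apply/setIdP.
    apply/negP => /setIdP[/imsetP[B FB eB] _]; move: eB.
    rewrite /shift; case: ifP => [/andP[Bx _] eA|nB eA].
      by have := mv _ FB Bx; rewrite -eA Ac.
    by move: nB; rewrite -eA Ai nA.
  have [zy|zy] := eqVneq z y.
    by rewrite zy in zP; apply: shift_star_same F_largest zP.
  exists z; exact: shift_star_other F_largest _ zy zP.
have [|x ->] := base_meet_star r_le F_largest; last by exists (inr x).
move=> A B FA FB; have /set0Pn[[i|p] /setIP[Ai Bi]] := F_meet _ _ FA FB; last first.
  by apply/set0Pn; exists p; rewrite !inE Ai.
(* When [A] and [B] share the central vertex [inl i], stability gives a member without central
   vertex that meets [B]; [B] cannot contain the neighbour [inr (i, l)] of [inl i], so the common
   point is a pendant vertex of [A]. *)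
have FA' : exchange (inl i : G) (inr (i, l) : G) A \in F.
  apply: contraR stable => nA; apply/existsP; exists i.
  by apply/exists_inP; exists A; rewrite // Ai.
have /set0Pn[[j|p]] := F_meet _ _ FA' FB; rewrite !inE.
  by case/andP=> /andP[ji Aj]; case/negP: ji; rewrite (central_uniq (FI _ FA) Aj Ai).
case/andP=> /predU1P[[->]|/andP[_ Ap]] Bp; last by apply/set0Pn; exists p; rewrite !inE Ap.
by have /independentP/(_ _ _ Bi Bp) := FI _ FB; rewrite pendant_adj.
Qed.

End Knm.

Theorem theorem4 (m n r : nat) (hm : 2 <= m) (hn : 0 < n) (hr : 0 < r)
  (hnr : 2 * r <= n) : EKR (Knm n m) r.
Proof. by case: r hr hnr => // r _; apply: Knm_EKR. Qed.
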